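(* There are absolute constants $Q_0<\infty$ and $\varepsilon_0>0$ such that the following holds. Let $2\le t\le q$ be integers with $q\ge Q_0t^2$, and let $e$ be an edge of a finite linear $C^{q+1}_{1,t+1}$-free $(q+1)$-uniform hypergraph $H$ with $$\delta_H(e)<\frac{\varepsilon_0}{t^3}.$$ Then at least $\tfrac12 r(D-1)$ neighbors $f$ of $e$ satisfy $$\delta_H(f)\ge\frac1{100t^2},$$ where $r=q+1$ and $D=tq+1$.
   Context: A hypergraph is $r$-uniform if every edge is an $r$-element set of vertices, and linear if any two distinct edges share at most one vertex. $d_H(v)$ is the number of edges of $H$ containing $v$. For $3\le k\le r$ the crown $C^r_{1,k}$ consists of a base edge $e_0$ and pairwise disjoint edges (petals) $e_1,\dots,e_k$ with $e_0\cap e_i=\{v_i\}$, where $v_1,\dots,v_k$ are distinct points of $e_0$; $H$ is $C^r_{1,k}$-free if it contains no such configuration of edges. With $r=q+1$, $k=t+1$, $D=tq+1$, the defect of an edge $f$ is $\delta_H(f)=\sum_{v\in f}\frac1{d_H(v)}-\frac{r}{D}$. A neighbor of $e$ is an edge $f\ne e$ of $H$ with $f\cap e\ne\varnothing$. *)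

(* Defs.v *)
From mathcomp Require Import all_boot all_order all_algebra.
From mathcomp Require Import reals.

Set Implicit Arguments.
Unset Strict Implicit.
Unset Printing Implicit Defensive.

Import Order.TTheory GRing.Theory Num.Theory.
Local Open Scope ring_scope.

(* A finite hypergraph is given by its vertex type T : finType and its set of
   edges E : {set {set T}}. *)

Definition uniform (T : finType) (r : nat) (E : {set {set T}}) : Prop :=
  forall f : {set T}, f \in E -> #|f| = r.

Definition linear_hypergraph (T : finType) (E : {set {set T}}) : Prop :=
  forall f g : {set T}, f \in E -> g \in E -> f != g -> (#|f :&: g| <= 1)%N.

Definition degree (T : finType) (E : {set {set T}}) (v : T) : nat :=
  #|[set f in E | v \in f]|.

(* Base edge e0 and petals p i, where p i meets e0 exactly in v i. *)
Definition is_crown (T : finType) (E : {set {set T}}) (k : nat)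
    (e0 : {set T}) (p : 'I_k -> {set T}) (v : 'I_k -> T) : Prop :=
  [/\ e0 \in E,
      forall i, p i \in E,
      forall i j, i != j -> [disjoint p i & p j],
      forall i, e0 :&: p i = [set v i] &
      injective v].

(* In an r-uniform hypergraph this is C^r_{1,k}-freeness, for 3 <= k <= r. *)
Definition crown_free (T : finType) (k : nat) (E : {set {set T}}) : Prop :=
  ~ exists e0 p v, @is_crown T E k e0 p v.

Definition defect (R : realType) (T : finType) (r D : nat)
    (E : {set {set T}}) (f : {set T}) : R :=
  \sum_(v in f) (degree E v)%:R^-1 - r%:R / D%:R.

Definition neighbors (T : finType) (E : {set {set T}}) (e : {set T}) :
    {set {set T}} :=
  [set f in E | (f != e) && (f :&: e != set0)].

(* Main.v *)
Require Import Defs.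
From mathcomp Require Import all_boot all_order all_algebra.
From mathcomp Require Import reals.
From mathcomp Require Import zify ring lra.
Import Order.TTheory GRing.Theory Num.Theory.

(** Throughout, an edge with defect close to 0 is studied through the
    deficiencies D - d(v) of its vertices, D = tq + 1.  Two pairwise disjoint
    neighbours of an edge b meet b in different points, so crown-freeness says
    that an edge has at most t pairwise disjoint neighbours.  A greedy choice
    of disjoint neighbours shows that an edge whose defect is below 1/(2t^2)
    has no vertex of degree above D ([degree_le_of_defect]); its total
    deficiency is then at most D^2 times its defect ([sum_deficiency_le]).

    Let e have tiny defect, with total deficiency sigma, and fix t pairwise
    disjoint neighbours of e, forming a set P.  Call the neighbours of e lines.
    By maximality every line meets a member of P.  The lines at free points of
    e (those on no member of P) that avoid all of P except p form a family, the
    plane of p, any two members of which meet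
    ([plane_meet]): otherwise they could replace p in P and give t + 1 disjoint
    lines.  Up to an error controlled by sigma, the lines split into t planes,
    each of them an almost complete projective plane of order q containing e:
    each free point u of e carries between q - def u and q lines of each plane
    ([card_pencil_plane], [card_pencil_plane_le]) and at most def u lines
    outside the planes ([card_exceptional]).  Hence two points of one plane
    are nearly always joined by a line ([card_unjoined]), and therefore few
    edges disjoint from e can lie almost inside the neighbourhood of a point v
    of e: by pigeonhole such an edge has many pairs of points in common planes,
    and none of these pairs is joined by a line ([card_absorbed]).

    The heart of the proof is that a line f of a plane, through a point v of e
    of small deficiency, has large total deficiency ([defective_line]).
    Otherwise most points x of f have degree close to D and lie on almost q
    lines of the plane, and there is a crown with base f.  One petal is a line
    h of the same plane through a point w of f.  Each of t - 1 further points x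
    of f lies on roughly (t - 1)q edges disjoint from e, and nearly all of
    these avoid h too, because h is almost covered by the lines of the plane
    through x; so t - 1 disjoint petals can be chosen there greedily, the
    first of them, g, with more than def v points outside the neighbourhood
    of v.  These t petals have tq points off f, and at least def v + 1 of them
    are not joined to v, so they cannot block all the tq - def v edges through
    v other than f: a petal at v remains, and it completes the crown.

    Since e has small total deficiency, all but a small fraction of the
    r(D - 1) possible incidences of lines with e are of this kind, which gives
    [many_defective] and then the theorem. *)

Set Implicit Arguments.
Unset Strict Implicit.
Unset Printing Implicit Defensive.

(** * Elementary inequalities *)

Lemma leq_subS_add n a c : c < a -> a <= n.+1 -> n.+1 - a + c <= n.
Proof. lia. Qed.

Lemma leq_complement n a b c d : c + d = n -> a <= b.+1 -> b <= c ->
  d <= n.+1 - a.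
Proof. lia. Qed.

(** Pigeonhole for pairs: a mass of at least n/2 spread over at most n/4 cells
    has about n^2 / (4 #|A|) coincidences; the linear term removes the trivial
    pairs. *)
Lemma sum_sqr_ge (I : finType) (A : {set I}) (F : I -> nat) n :
  4 * #|A| <= n -> n <= 2 * \sum_(i in A) F i ->
  n * n + 8 * #|A| * (\sum_(i in A) F i) <= 8 * #|A| * \sum_(i in A) F i ^ 2.
Proof.
move=> nA nF; have [A0|A0] := posnP #|A|.
  move: nF; rewrite A0 (cards0_eq A0) big_set0; lia.
have : \sum_(i in A) 4 * n * #|A| * F i <=
    \sum_(i in A) (4 * #|A| * #|A| * F i ^ 2 + n * n).
  apply: leq_sum => i _.
  by have := (nat_Cauchy (2 * #|A| * F i) n).1; rewrite -!mulnn; move: #|A| (F i); clear; nia.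
rewrite big_split /= sum_nat_const -!big_distrr /=.
move: #|A| (\sum_(i in A) F i) (\sum_(i in A) F i ^ 2) A0 nA nF; clear.
move=> a N N2 a0 an nN le1.
have le2 : 4 * n * N <= 4 * a * N2 + n * n by rewrite -(leq_pmul2l a0); nia.
nia.
Qed.

(** Point count for an edge of n + 1 points that misses m of them: at least
    half of n points survive two losses of size at most n/4. *)
Lemma leq_half_cover n a m s d : a + m = n.+1 -> a <= s + d -> m <= d ->
  4 * d <= n -> n <= 2 * s.
Proof. lia. Qed.

(** Here c (tn) / 8 bounds from below a number of candidate petals and is at
    least t n^2 / 16, whereas the upper bound of [card_absorbed] for them is at
    most 16 t n^2 / 1000. *)
Lemma absorbed_bound_fails n t s c : 2 <= t -> 0 < n -> 1000 * t ^ 2 <= n ->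
  1000 * (t * s) <= n * n -> n <= 2 * c ->
  ~ c * (t * n) <= 8 * (8 * t * (t * (t * n + s))).
Proof.
rewrite -mulnn => t2 n0 tn sn nc le1.
have lo : n * (t * n) <= 2 * c * (t * n) by rewrite leq_mul2r nc orbT.
have hi : 1000 * (t * (t * n + s)) <= 2 * (n * n).
  have : 1000 * (t * t) * n <= n * n by rewrite leq_mul2r tn orbT.
  by move: sn; clear; nia.
have : 1000 * (n * (t * n)) <= 128 * t * (2 * (n * n)).
  apply: leq_trans (_ : 128 * t * (1000 * (t * (t * n + s))) <= _).
    by move: lo le1; clear; lia.
  by rewrite leq_mul2l hi orbT.
have : 0 < t * (n * n) by rewrite !muln_gt0 n0; case: (t) t2.
by clear; nia.
Qed.

Lemma many_good n t s d c : 2 <= t -> 0 < n -> 1000 * t ^ 2 <= n ->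
  1000 * (t * s) <= n * n -> 25 * d <= n * n ->
  n * n <= n * c + 4 * (t * n + s) + 2 * d -> 3 * n <= 4 * c.
Proof.
rewrite -mulnn => t2 n0 tn sn dn le1.
have tn1 : 1000 * (t * t) * n <= n * n by rewrite leq_mul2r tn orbT.
have : 100 * (t * n + s) <= n * n by move: sn tn1 t2; clear; nia.
rewrite -(leq_pmul2l n0); move: dn le1; clear; nia.
Qed.

Lemma petal_room n t d m a b : 0 < t -> a.+1 = d -> d <= t * n + 1 ->
  t * n + 1 - d < m -> b + m <= n -> t.-1 * n + b < a.
Proof. by case: t => // t _; rewrite mulSn /=; lia. Qed.

Section FractionGap.
Local Open Scope ring_scope.

(** Here a = t - 1 and b = q.  The difference of the two fractions is of order
    1/(a + 1)^2, and the factor 1000 leaves room for the lower order terms. *)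
Lemma fraction_gap (R : realFieldType) (a b : R) :
  1 <= a -> 1000 * (a + 1) ^+ 2 <= b ->
  1 / (2 * (a + 1) ^+ 2) + (b + 1) / ((a + 1) * b + 1) <= (b - a) / (a * b + 1).
Proof.
move=> a1 ab.
have b1 : 1000 * (a + 1) <= b by nra.
have d1 : 0 < a * b + 1 by nra.
have d2 : 0 < (a + 1) * b + 1 by nra.
have -> : (b - a) / (a * b + 1) = (b + 1) / ((a + 1) * b + 1) +
    (b ^+ 2 - (a + 1) ^+ 2 * b + b - a - 1) / ((a * b + 1) * ((a + 1) * b + 1)).
  by field; rewrite !gt_eqF.
rewrite addrC lerD2l ler_pdivlMr ?mulr_gt0 // mul1r ler_pdivrMl; last first.
  by rewrite mulr_gt0 // exprn_gt0 //; lra.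
have up : (a * b + 1) * ((a + 1) * b + 1) <= (a + 1) ^+ 2 * b ^+ 2 by nra.
have lo : b ^+ 2 <= 2 * (b ^+ 2 - (a + 1) ^+ 2 * b + b - a - 1) by nra.
apply: le_trans up _.
have : (a + 1) ^+ 2 * b ^+ 2 <= (a + 1) ^+ 2 *
    (2 * (b ^+ 2 - (a + 1) ^+ 2 * b + b - a - 1)).
  by rewrite ler_wpM2l // exprn_ge0 //; lra.
lra.
Qed.

End FractionGap.

(** * Incidence counting in families of sets *)

Section SetFamilies.
Variable T : finType.
Implicit Types (C P : {set {set T}}) (S k : {set T}) (x y v : T).

Definition pencil C v : {set {set T}} := [set k in C | v \in k].
Definition meeting C S : {set {set T}} := [set k in C | ~~ [disjoint k & S]].

Lemma in_pencil C v k : (k \in pencil C v) = (k \in C) && (v \in k).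
Proof. by rewrite inE. Qed.

Lemma in_meeting C S k : (k \in meeting C S) = (k \in C) && ~~ [disjoint k & S].
Proof. by rewrite inE. Qed.

Lemma sum_pencil C S :
  \sum_(y in S) #|pencil C y| = \sum_(k in C) #|k :&: S|.
Proof.
under eq_bigr => y _ do rewrite -sum1_card.
rewrite (exchange_big_dep (fun k => k \in C)) /=; last first.
  by move=> y k _; rewrite inE => /andP[].
apply: eq_bigr => k kC; rewrite -sum1_card; apply: eq_bigl => y.
by rewrite !inE kC /= andbC.
Qed.

Lemma sum_cover_le C S (F : T -> nat) :
  \sum_(y in cover C :\: S) F y <= \sum_(k in C) \sum_(y in k :\: S) F y.
Proof.
rewrite [leqRHS](exchange_big_dep (fun y => y \in cover C :\: S)) /=.
  apply: leq_sum => y /setDP[/bigcupP[k kC yk] yS].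
  by rewrite (bigD1 k) ?kC ?inE ?yk ?yS //= leq_addr.
move=> k y kC /setDP[yk yS]; rewrite inE yS.
by apply/bigcupP; exists k.
Qed.

Lemma card_cover_le C S : #|cover C :\: S| <= \sum_(k in C) #|k :\: S|.
Proof.
rewrite -sum1_card; apply: leq_trans (sum_cover_le _ _ _) _.
by apply: leq_sum => k _; rewrite sum1_card.
Qed.

Lemma card_setI_sum S k : #|S :&: k| = \sum_(y in S) (y \in k).
Proof.
rewrite -sum1_card big_mkcond [RHS]big_mkcond /=; apply: eq_bigr => y _.
by rewrite inE; case: (y \in S); case: (y \in k).
Qed.

Lemma sub_cover C k : k \in C -> k \subset cover C.
Proof. by move=> kC; apply: (bigcup_max k). Qed.

Lemma disjoint_cover C S :
  [disjoint S & cover C] = [forall k in C, [disjoint S & k]].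
Proof.
apply/idP/forall_inP => [dS k kC|dS].
  exact: disjointWr (sub_cover kC) dS.
apply/pred0P => y /=; apply/negP => /andP[yS /bigcupP[k kC yk]].
by have /pred0P/(_ y) := dS k kC; rewrite /= yS yk.
Qed.

Lemma overlapP S k : reflect (exists2 y, y \in S & y \in k) (~~ [disjoint S & k]).
Proof.
apply: (iffP pred0Pn) => [[y /andP[]]|[y yS yk]]; first by exists y.
by exists y; rewrite /= yS.
Qed.
End SetFamilies.

Section LinearHypergraphs.
Variables (T : finType) (q : nat) (H : {set {set T}}).
Hypothesis uniH : uniform q.+1 H.
Hypothesis linH : linear_hypergraph H.
Implicit Types (C P : {set {set T}}) (S b e f g k p : {set T}) (x y v : T).

Lemma edge_eq f g x y : f \in H -> g \in H -> x \in f -> x \in g ->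
  y \in f -> y \in g -> x != y -> f = g.
Proof.
move=> fH gH xf xg yf yg; apply: contraNeq => /(linH fH gH) le1.
by apply/eqP; apply: (card_le1_eqP le1 y x); rewrite inE ?xf ?xg ?yf ?yg.
Qed.

Lemma meet_point f g x y : f \in H -> g \in H -> f != g -> x \in f -> x \in g ->
  y \in f -> y \in g -> y = x.
Proof.
move=> fH gH fg xf xg yf yg; apply: contraNeq fg => yx.
by apply/eqP; apply: (edge_eq fH gH yf yg xf xg yx).
Qed.

Lemma neighborsP b k :
  reflect [/\ k \in H, k != b & exists2 x, x \in k & x \in b]
          (k \in neighbors H b).
Proof.
rewrite inE; apply: (iffP and3P) => -[kH kb].
  by move=> /set0Pn[x]; rewrite inE => /andP[xk xb]; split=> //; exists x.
by case=> x xk xb; split=> //; apply/set0Pn; exists x; rewrite inE xk.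
Qed.

Lemma mem_pencil_nbr b k x : x \in b ->
  (k \in pencil (neighbors H b) x) = [&& k \in H, k != b & x \in k].
Proof.
move=> xb; rewrite inE; apply/andP/and3P => [[/neighborsP[? ? _] ?]//|[? ? xk]].
by split=> //; apply/neighborsP; split=> //; exists x.
Qed.

Lemma card_pencil_nbr b x : b \in H -> x \in b ->
  #|pencil (neighbors H b) x|.+1 = degree H x.
Proof.
move=> bH xb; rewrite /degree [RHS](cardsD1 b) inE bH xb add1n; congr _.+1.
apply: eq_card => k; rewrite mem_pencil_nbr // !inE.
by case: (k \in H); case: (k == b).
Qed.

(** Edges through v are disjoint away from v, so each of those that meet S uses
    up its own point of S.  This is how linearity bounds the
    number of blocked petals. *)
Lemma card_meeting C v S : C \subset H -> v \notin S ->
  #|meeting (pencil C v) S| <= #|S :&: cover (pencil C v)|.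
Proof.
move=> /subsetP CH vS.
pose pt (k : {set T}) := odflt v [pick y in k :&: S].
have ptP k : k \in meeting (pencil C v) S ->
    [/\ k \in pencil C v, pt k \in k & pt k \in S].
  rewrite inE => /andP[kC /overlapP[y yk yS]]; rewrite /pt.
  case: pickP => [z|/(_ y)]; rewrite /= inE; first by case/andP.
  by rewrite yk yS.
rewrite -(card_in_imset (f := pt)) => [|k k' /ptP[kC ptk ptS] /ptP[kC' ptk' _]].
  apply/subset_leq_card/subsetP => _ /imsetP[k /ptP[kC ptk ptS] ->].
  by rewrite inE ptS; apply: (subsetP (sub_cover kC)).
move=> eqpt; move: kC kC'; rewrite !inE => /andP[kC vk] /andP[kC' vk'].
apply: (edge_eq (CH _ kC) (CH _ kC') vk vk' ptk); rewrite ?eqpt //.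
by apply: contraNneq vS => ->; rewrite -eqpt.
Qed.

Lemma nbr_sub b : neighbors H b \subset H.
Proof. by apply/subsetP => k /neighborsP[]. Qed.

Lemma card_edgeD b k : b \in H -> k \in neighbors H b -> #|k :\: b| = q.
Proof.
move=> bH /neighborsP[kH kb [x xk xb]].
have := cardsID b k; rewrite (uniH kH).
have -> : k :&: b = [set x]; last by rewrite cards1 add1n => -[].
apply/eqP; rewrite eq_sym eqEcard sub1set inE xk xb cards1.
exact: linH.
Qed.

Lemma card_coverD b P : b \in H -> P \subset neighbors H b ->
  #|cover P :\: b| <= #|P| * q.
Proof.
move=> bH /subsetP Pb; rewrite -sum_nat_const.
apply: leq_trans (card_cover_le _ _) _.
by apply: leq_sum => p /Pb pb; rewrite card_edgeD.
Qed.

(** By linearity each neighbour of b is counted at one point of b only. *)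
Lemma sum_pencil_nbr_le b C S : b \in H -> C \subset neighbors H b ->
  S \subset b -> \sum_(x in S) #|pencil C x| <= #|C|.
Proof.
move=> bH /subsetP Cb Sb; rewrite sum_pencil -sum1_card; apply: leq_sum => k kC.
have /neighborsP[kH kb _] := Cb k kC.
exact: leq_trans (subset_leq_card (setIS _ Sb)) (linH _ _ _).
Qed.

(** The petals of a crown with base b.  Pairwise disjointness already forces the
    points of attachment to b to be distinct, so they need not be recorded. *)
Definition petal_family b P := (P \subset neighbors H b) && trivIset P.

Lemma petal_familyU1 b P k : b \in H -> petal_family b P ->
  k \in neighbors H b -> [disjoint k & cover P] ->
  petal_family b (k |: P) /\ #|k |: P| = #|P|.+1.
Proof.
move=> bH /andP[Pb tP] kb; rewrite disjoint_cover => /forall_inP dk.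
have P0 : set0 \notin P by apply/negP => /(subsetP Pb)/neighborsP[/uniH]; rewrite cards0.
have [tkP kP] := trivIsetU1 dk tP P0.
split; last by rewrite cardsU1 kP.
by rewrite /petal_family tkP subUset sub1set kb Pb.
Qed.

Lemma petal_family_le t b P : crown_free t.+1 H -> b \in H ->
  petal_family b P -> #|P| <= t.
Proof.
move=> cf bH /andP[/subsetP Pb /trivIsetP tP]; rewrite leqNgt; apply/negP => ltP.
have [x0 x0b] : exists x0, x0 \in b by apply/card_gt0P; rewrite (uniH bH).
pose p (i : 'I_t.+1) := enum_val (widen_ord ltP i).
have pP i : p i \in P by apply: enum_valP.
have pd i j : i != j -> [disjoint p i & p j].
  move=> ij; apply: tP => //; apply: contraNneq ij => /enum_val_inj eqij.
  by apply/eqP/val_inj; move/(congr1 val): eqij.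
pose v i := odflt x0 [pick x in b :&: p i].
have vP i : v i \in b :&: p i.
  rewrite /v; case: pickP => //= b0; have /neighborsP[_ _ [x xp xb]] := Pb _ (pP i).
  by have := b0 x; rewrite !inE xp xb.
apply: cf; exists b, p, v; split=> // [i|i|i j eqv].
- by case/neighborsP: (Pb _ (pP i)).
- have /neighborsP[pH pb _] := Pb _ (pP i).
  apply/eqP; rewrite eq_sym eqEcard sub1set vP cards1.
  by apply: linH => //; rewrite eq_sym.
- apply/eqP/negPn/negP => /pd /pred0P/(_ (v i)) /=.
  by have := vP i; have := vP j; rewrite -eqv !inE => /andP[_ ->] /andP[_ ->].
Qed.

(** The petals in P have #|P| * q points off b, and each of them lies on at most
    one edge through x: more than #|P| * q candidates at x cannot all be
    blocked. *)
Lemma petal_extend1 b P x C : b \in H -> petal_family b P -> x \in b ->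
  x \notin cover P -> C \subset pencil (neighbors H b) x -> #|P| * q < #|C| ->
  exists2 k, k \in C & petal_family b (k |: P) /\ #|k |: P| = #|P|.+1.
Proof.
move=> bH Pf xb xP Cx ltC; have /andP[Pb _] := Pf.
have : ~~ (C \subset meeting (pencil (neighbors H b) x) (cover P :\: b)).
  apply/negP => /subset_leq_card /(leq_trans ltC).
  rewrite ltnNge => /negP; apply; apply: leq_trans (card_coverD bH Pb).
  apply: leq_trans (card_meeting (nbr_sub b) _) _; first by rewrite inE xb.
  exact/subset_leq_card/subsetIl.
case/subsetPn => k kC; rewrite inE (subsetP Cx) //= negbK => dk.
have := subsetP Cx _ kC; rewrite inE => /andP[kb xk].
exists k => //; apply: petal_familyU1 => //.
apply/pred0P => y /=; apply/negP => /andP[yk yP].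
have /neighborsP[kH knb _] := kb.
have [yb|yb] := boolP (y \in b); last first.
  by have /pred0P/(_ y) := dk; rewrite /= inE yk yb yP.
by rewrite (meet_point kH bH knb xk xb yk yb) (negPf xP) in yP.
Qed.

(** Greedy choice: as long as fewer than n petals are chosen, at most n.-1 * q
    candidates at a new point are blocked. *)
Lemma petal_extend n b P S (C : T -> {set {set T}}) : b \in H ->
  petal_family b P -> S \subset b -> [disjoint S & cover P] ->
  (forall x, x \in S -> C x \subset pencil (neighbors H b) x) ->
  (forall x, x \in S -> n.-1 * q < #|C x|) ->
  #|P| <= n <= #|P| + #|S| ->
  exists P', [/\ petal_family b P', #|P'| = n, P \subset P' &
    forall k, k \in P' -> k \in P \/ exists2 x, x \in S & k \in C x].
Proof.
move=> bH; have [m] := ubnP (n - #|P|); elim: m P S => // m IH P S ltm.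
move=> Pf Sb dS CS ltC /andP[Pn nPS].
have [eqn|neqn] := eqVneq #|P| n; first by exists P; split=> //; left.
have ltPn : #|P| < n by rewrite ltn_neqAle neqn.
have /card_gt0P[x xS] : 0 < #|S| by lia.
have xb := subsetP Sb x xS.
have xP : x \notin cover P.
  by apply/negP => xP; have /pred0P/(_ x) := dS; rewrite /= xS xP.
have ltCx : #|P| * q < #|C x|.
  by apply: leq_ltn_trans (ltC x xS); rewrite leq_mul2r; apply/orP; right; lia.
have [k kC [kPf ck]] := petal_extend1 bH Pf xb xP (CS x xS) ltCx.
have [||||||P' [P'f cP' kP' inP']] := IH (k |: P) (S :\ x) _ kPf.
- by rewrite ck; lia.
- by apply: subset_trans Sb; apply: subsetDl.
- apply/pred0P => y /=; apply/negP => /andP[]; rewrite !inE => /andP[yx yS].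
  case/bigcupP => p; rewrite !inE => /orP[/eqP->|pP] yk.
    have := subsetP (CS x xS) _ kC; rewrite inE => /andP[/neighborsP[kH kb _] xk].
    by case/eqP: yx; apply: (meet_point kH bH kb xk xb yk (subsetP Sb _ yS)).
  by have /pred0P/(_ y) := dS; rewrite /= yS (subsetP (sub_cover pP)).
- by move=> y /setD1P[_ yS]; apply: CS.
- by move=> y /setD1P[_ yS]; apply: ltC.
- by rewrite ck; have := cardsD1 x S; rewrite xS; lia.
exists P'; split=> //; first by apply: subset_trans kP'; apply: subsetUr.
move=> p /inP'[|[y /setD1P[_ yS] pC]]; last by right; exists y.
by rewrite !inE => /orP[/eqP->|]; [right; exists x | left].
Qed.
End LinearHypergraphs.

(** * Planes at an edge of small deficiency *)

Definition deficiency (T : finType) (D : nat) (H : {set {set T}}) (v : T) :=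
  D - degree H v.

Section Planes.
Variables (T : finType) (q t : nat) (H : {set {set T}}).
Hypothesis uniH : uniform q.+1 H.
Hypothesis linH : linear_hypergraph H.
Hypothesis cfH : crown_free t.+1 H.
Variables (e : {set T}) (P : {set {set T}}).
Hypothesis eH : e \in H.
Hypothesis degE : forall u, u \in e -> degree H u <= t * q + 1.
Hypothesis Pf : petal_family H e P.
Hypothesis cP : #|P| = t.
Implicit Types (k l p : {set T}) (u v y : T).

Local Notation def := (deficiency (t * q + 1) H).
Local Notation line := (neighbors H e).

(** The lines avoiding the points of attachment of P and meeting no member of P
    but, necessarily, p itself.  The members of P are thereby left out. *)
Definition plane p : {set {set T}} :=
  [set k in line | [disjoint k & (e :&: cover P) :|: cover (P :\ p)]].

Lemma family_lines : P \subset line. Proof. by case/andP: Pf. Qed.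

Lemma card_lines u : u \in e -> #|pencil line u| + def u = t * q.
Proof.
move=> ue; have := degE ue; have := card_pencil_nbr eH ue.
by rewrite /deficiency; move: #|_| (degree H u); clear; lia.
Qed.

Lemma line_base k u y : k \in pencil line u -> u \in e -> y \in k -> y \in e ->
  y = u.
Proof.
rewrite inE => /andP[/neighborsP[kH ke _] uk] ue yk ye.
exact: (meet_point linH kH eH ke uk ue yk ye).
Qed.

(** P is a maximal family of disjoint lines, by crown-freeness. *)
Lemma line_meets k : k \in line -> exists2 p, p \in P & ~~ [disjoint k & p].
Proof.
move=> ke; apply/exists_inP; apply: contraT.
rewrite negb_exists_in => /forall_inP dk.
have dkP : [disjoint k & cover P].
  by rewrite disjoint_cover; apply/forall_inP => p /dk; rewrite negbK.
have [kPf ck] := petal_familyU1 uniH eH Pf ke dkP.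
by have := petal_family_le uniH linH cfH eH kPf; rewrite ck cP ltnn.
Qed.

Lemma plane_line p k : k \in plane p -> k \in line.
Proof. by rewrite inE => /andP[]. Qed.

Lemma plane_edge p k : k \in plane p -> k \in H.
Proof. by move/plane_line/neighborsP; case. Qed.

Lemma mem_plane p k : (k \in plane p) =
  [&& k \in line, [disjoint k & e :&: cover P] & [disjoint k & cover (P :\ p)]].
Proof. by rewrite inE -!setI_eq0 setIUr setU_eq0. Qed.

Lemma sub_pencil_plane p u : pencil (plane p) u \subset pencil line u.
Proof.
apply/subsetP => k; rewrite ![_ \in pencil _ _]inE => /andP[/plane_line -> ->] //.
Qed.

(** If k and k' were disjoint, replacing p by both of them in P would give
    t + 1 pairwise disjoint lines. *)
Lemma plane_meet p k k' : p \in P -> k \in plane p -> k' \in plane p ->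
  exists2 y, y \in k & y \in k'.
Proof.
move=> pP; rewrite !mem_plane => /and3P[ke _ dk] /and3P[k'e _ dk'].
apply/overlapP/negP => dkk'.
have := cardsD1 p P; rewrite pP cP /= add1n => cPp.
have P'f : petal_family H e (P :\ p).
  have /andP[Pe tP] := Pf; apply/andP; split; last exact: trivIsetD.
  exact: subset_trans (subsetDl _ _) Pe.
have [kPf ck] := petal_familyU1 uniH eH P'f ke dk.
have dk'k : [disjoint k' & cover (k |: P :\ p)].
  rewrite disjoint_cover; apply/forall_inP => m /setU1P[->|].
    by rewrite disjoint_sym.
  by move: dk'; rewrite disjoint_cover => /forall_inP; apply.
have [k'Pf ck'] := petal_familyU1 uniH eH kPf k'e dk'k.
have := petal_family_le uniH linH cfH eH k'Pf.
by rewrite ck' ck -cPp ltnn.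
Qed.

Lemma free_disjoint k u p : u \in e :\: cover P -> k \in pencil line u ->
  p \in P -> [disjoint k & p :\: e] = [disjoint k & p].
Proof.
move=> /setDP[ue uP] ku pP; apply/idP/idP; last first.
  by apply: disjointWr; apply: subsetDl.
apply: contraTT => /overlapP[y yk yp]; apply/overlapP; exists y => //.
rewrite inE yp andbT; apply: contra uP => ye.
by rewrite -(line_base ku ue yk ye); apply: (subsetP (sub_cover pP)).
Qed.

Lemma free_plane k u p : u \in e :\: cover P -> k \in pencil line u ->
  [disjoint k & cover (P :\ p) :\: e] -> k \in plane p.
Proof.
move=> /[dup] uf /setDP[ue uP] ku dk; rewrite mem_plane.
have kl : k \in line by move: ku; rewrite inE => /andP[].
apply/and3P; split=> //.
  apply/pred0P => y /=; apply/negP => /andP[yk /setIP[ye yP]].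
  by rewrite -(line_base ku ue yk ye) yP in uP.
rewrite disjoint_cover; apply/forall_inP => p' p'P.
rewrite -(free_disjoint uf ku); last by case/setD1P: p'P.
by apply: disjointWr dk; apply: setSD; apply: sub_cover.
Qed.

(** At most (t - 1)q of the tq - def u lines through u are blocked by the t - 1
    members of P other than p. *)
Lemma card_pencil_plane p u : p \in P -> u \in e :\: cover P ->
  q <= #|pencil (plane p) u| + def u.
Proof.
move=> pP /[dup] uf /setDP[ue uP].
have PpS : P :\ p \subset line by apply: subset_trans (subsetDl _ _) family_lines.
have le1 : #|meeting (pencil line u) (cover (P :\ p) :\: e)| <= t.-1 * q.
  have -> : t.-1 = #|P :\ p| by rewrite -cP (cardsD1 p P) pP.
  apply: leq_trans (card_coverD uniH linH eH PpS).
  apply: leq_trans (card_meeting linH (nbr_sub _ _) _) _; first by rewrite inE ue.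
  exact/subset_leq_card/subsetIl.
have le2 : #|pencil line u| <= #|pencil (plane p) u| +
    #|meeting (pencil line u) (cover (P :\ p) :\: e)|.
  apply: leq_trans (leq_card_setU _ _).1.
  apply/subset_leq_card/subsetP => k ku; rewrite in_setU.
  rewrite [k \in meeting _ _]inE ku /=.
  have [dk|] := boolP [disjoint k & _]; last by rewrite orbT.
  rewrite orbF.
  rewrite inE (free_plane uf ku dk) /=; move: ku; rewrite inE.
  by case/andP.
have := card_lines ue; have := cardsD1 p P; rewrite pP cP; nia.
Qed.

(** For a free point u these are the lines through u that meet at least two
    members of P. *)
Definition exceptional u : {set {set T}} :=
  [set k in pencil line u | [forall p in P, k \notin plane p]].

(** Each of the tq points of P off e lies on at most one line through u, each of
    the tq - def u lines uses at least one of them, and an exceptional line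
    uses two. *)
Lemma card_exceptional u : u \in e :\: cover P -> #|exceptional u| <= def u.
Proof.
move=> /[dup] uf /setDP[ue uP].
have le1 : \sum_(p in P) #|meeting (pencil line u) (p :\: e)| <= t * q.
  rewrite -cP -sum_nat_const; apply: leq_sum => p pP.
  rewrite -(card_edgeD uniH linH eH (subsetP family_lines p pP)).
  apply: leq_trans (card_meeting linH (nbr_sub _ _) _) _; first by rewrite inE ue.
  exact/subset_leq_card/subsetIl.
have le2 : #|pencil line u| + #|exceptional u| <=
    \sum_(p in P) #|meeting (pencil line u) (p :\: e)|.
  under eq_bigr => p _ do rewrite -sum1_card.
  rewrite (exchange_big_dep (fun k => k \in pencil line u)) /=; last first.
    by move=> p k _; rewrite inE => /andP[].
  have -> : #|exceptional u| =
      \sum_(k in pencil line u) (k \in exceptional u : nat).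
    rewrite -sum1_card big_mkcond [RHS]big_mkcond /=; apply: eq_bigr => k _.
    by rewrite [k \in exceptional u]inE; case: (k \in pencil _ _) => //; case: ifP.
  rewrite -sum1_card -big_split /=; apply: leq_sum => k ku.
  have kl : k \in line by move: ku; rewrite inE => /andP[].
  have [p pP kp] := line_meets kl.
  rewrite (bigD1 p) /=; last by rewrite pP inE ku (free_disjoint uf ku).
  rewrite leq_add2l; case kx: (k \in exceptional u) => //.
  move: kx; rewrite inE ku /= => /forall_inP/(_ p pP) kNp.
  have : ~~ [disjoint k & cover (P :\ p) :\: e].
    by apply: contra kNp; apply: (free_plane uf ku).
  case/overlapP=> y yk /setDP[/bigcupP[p' /setD1P[p'p p'P] yp'] ye].
  rewrite (bigD1 p') //= p'P p'p inE ku andbT /=.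
  by apply/overlapP; exists y => //; rewrite inE yp' ye.
by have := card_lines ue; lia.
Qed.

(** Lines of the plane through u all meet p, in distinct points off e. *)
Lemma card_pencil_plane_le p u : p \in P -> u \in e :\: cover P ->
  #|pencil (plane p) u| <= q.
Proof.
move=> pP /[dup] uf /setDP[ue uP].
rewrite -(card_edgeD uniH linH eH (subsetP family_lines p pP)).
have plH : plane p \subset H by apply/subsetP => k /plane_edge.
apply: (leq_trans _ (subset_leq_card (subsetIl _ (cover (pencil (plane p) u))))).
apply: (leq_trans _ (card_meeting linH plH _)); last by rewrite inE ue.
apply/subset_leq_card/subsetP => k kp; rewrite inE kp /=.
have ku := subsetP (sub_pencil_plane p u) k kp.
rewrite (free_disjoint uf ku pP).
have kl : k \in line by move: ku; rewrite inE => /andP[].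
have [p' p'P] := line_meets kl; have [-> //|p'p] := eqVneq p' p.
move: kp; rewrite inE mem_plane disjoint_cover => /andP[/and3P[_ _ /forall_inP dk] _].
by rewrite (dk p') // in_setD1 p'p.
Qed.

Local Notation sigma := (\sum_(u in e) def u).

Lemma card_bases : #|e :&: cover P| <= t.
Proof.
rewrite -cP; apply: leq_trans (sum_pencil_nbr_le linH eH family_lines (subsetIl e (cover P))).
rewrite -sum1_card; apply: leq_sum => y /setIP[_ /bigcupP[p pP yp]].
by apply/card_gt0P; exists p; rewrite inE pP.
Qed.

Lemma card_pencil_plane_out p y : y \notin e -> #|pencil (plane p) y| <= q.+1.
Proof.
move=> ye; rewrite -(uniH eH).
have plH : plane p \subset H by apply/subsetP => k /plane_edge.
apply: (leq_trans _ (subset_leq_card (subsetIl _ (cover (pencil (plane p) y))))).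
apply: (leq_trans _ (card_meeting linH plH ye)).
apply/subset_leq_card/subsetP => k kp; rewrite inE kp /=.
move: kp; rewrite inE => /andP[/plane_line/neighborsP[_ _ [x xk xe]] _].
by apply/overlapP; exists x.
Qed.

Lemma line_point l v y : l \in pencil line v -> v \in e -> y \in l :\ v ->
  y \notin e.
Proof.
move=> lv ve /setD1P[yv yl]; apply: contra yv => ye.
by rewrite (line_base lv ve yl ye).
Qed.

Lemma card_line_point l v : l \in pencil line v -> #|l :\ v| = q.
Proof.
rewrite inE => /andP[/neighborsP[/uniH lq _ _] vl].
by have := cardsD1 v l; rewrite vl lq add1n => -[].
Qed.

(** The lines of the plane that cross every plane line through v in a point
    other than v. *)
Definition opposite p v := [set k in plane p | v \notin k].

Lemma in_opposite p v k : (k \in opposite p v) = (k \in plane p) && (v \notin k).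
Proof. by rewrite inE. Qed.

Lemma card_opposite p v : p \in P -> v \in e ->
  (q - t) * q <= #|opposite p v| + sigma.
Proof.
move=> pP ve; set U := (e :\: cover P) :\ v.
have Ue : U \subset e by apply: subset_trans (subsetDl _ _) (subsetDl _ _).
have oppE : opposite p v \subset line.
  by apply/subsetP => k; rewrite inE => /andP[/plane_line].
have leU : q - t <= #|U|.
  have := cardsID (cover P) e; have := card_bases; rewrite (uniH eH).
  by have := cardsD1 v (e :\: cover P); rewrite -/U; lia.
apply: leq_trans (_ : #|U| * q <= _); first by rewrite leq_mul2r leU orbT.
rewrite -sum_nat_const.
apply: leq_trans (_ : \sum_(u in U) (#|pencil (opposite p v) u| + def u) <= _).
  apply: leq_sum => u /setD1P[uv uf].
  apply: leq_trans (card_pencil_plane pP uf) _; rewrite leq_add2r.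
  apply/subset_leq_card/subsetP => k kp; have kl := subsetP (sub_pencil_plane p u) k kp.
  move: kp; rewrite !in_pencil in_opposite => /andP[-> uk]; rewrite uk andbT /=.
  apply: contra uv => vk; have /setDP[ue _] := uf.
  by rewrite (line_base kl ue vk ve).
rewrite big_split; apply: leq_add; first exact: sum_pencil_nbr_le eH oppE Ue.
by rewrite [leqRHS](big_setID U) /= (setIidPr Ue) leq_addr.
Qed.

Lemma opposite_meet p v l k : p \in P -> l \in pencil (plane p) v ->
  k \in opposite p v -> exists2 y, y \in l :\ v & y \in k.
Proof.
move=> pP; rewrite in_pencil in_opposite => /andP[lp vl] /andP[kp vk].
have [y yl yk] := plane_meet pP lp kp; exists y => //.
by rewrite in_setD1 yl andbT; apply: contraNneq vk => <-.
Qed.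

(** All lines of the plane at points of e other than v cross l, which makes
    about q^2 incidences with the q points of l off e.  Counting l
    itself as well, these points are on average on almost q + 1 lines of the
    plane, the maximum. *)
Lemma sum_plane_deficit p l v : p \in P -> v \in e -> l \in pencil (plane p) v ->
  \sum_(y in l :\ v) (q.+1 - #|pencil (plane p) y|) <= t * q + sigma.
Proof.
move=> pP ve lv; have lv' := subsetP (sub_pencil_plane p v) l lv.
have /andP[lp vl] : (l \in plane p) && (v \in l) by move: lv; rewrite inE.
have le1 : #|opposite p v| <= \sum_(y in l :\ v) #|pencil (opposite p v) y|.
  rewrite sum_pencil -sum1_card; apply: leq_sum => k ko.
  have [y yl yk] := opposite_meet pP lv ko.
  by apply/card_gt0P; exists y; rewrite inE yk.
have le2 : \sum_(y in l :\ v) (q.+1 - #|pencil (plane p) y|) +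
    \sum_(y in l :\ v) #|pencil (opposite p v) y| <= q * q.
  rewrite -big_split /= -[X in _ <= X * _](card_line_point lv') -sum_nat_const.
  apply: leq_sum => y yl; have ye := line_point lv' ve yl.
  apply: leq_subS_add (card_pencil_plane_out p ye).
  apply/proper_card/properP; split.
    by apply/subsetP => k; rewrite !in_pencil in_opposite => /andP[/andP[-> _] ->].
  exists l; last by rewrite in_pencil in_opposite vl !andbF.
  by rewrite in_pencil lp; case/setD1P: yl.
have := leq_add le2 (leq_trans (card_opposite pP ve) (leq_add le1 (leqnn sigma))).
rewrite mulnBl; move: (\sum_(y in _) _) (\sum_(y in _) _) sigma => x y z.
clear; lia.
Qed.

(** The lines of the plane through y cross l in distinct points, so a point y on
    nearly q + 1 of them is joined to nearly all of l. *)
Lemma card_unjoined_line p v l y : p \in P -> l \in pencil (plane p) v ->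
  y \notin l ->
  #|(l :\ v) :\: cover (pencil (plane p) y)| <= q.+1 - #|pencil (plane p) y|.
Proof.
move=> pP lv yl; have lv' := subsetP (sub_pencil_plane p v) l lv.
have /andP[lp vl] : (l \in plane p) && (v \in l) by move: lv; rewrite inE.
have yv : y != v by apply: contraNneq yl => ->.
have yS : y \notin l :\ v by rewrite inE (negPf yl) andbF.
have oH : opposite p v \subset H.
  by apply/subsetP => k; rewrite inE => /andP[/plane_edge].
have le1 : #|pencil (plane p) y| <= #|pencil (opposite p v) y|.+1.
  have -> : #|pencil (plane p) y| = #|pencil (opposite p v) y| +
     #|pencil (pencil (plane p) v) y|.
    rewrite -(cardsID (opposite p v)); congr (_ + _); apply: eq_card => k.
      rewrite !(in_setI, in_pencil, in_opposite).
      by case: (k \in plane p); rewrite /= ?andbF // andbC.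
    rewrite !(in_setD, in_pencil, in_opposite).
    by case: (k \in plane p); case: (v \in k); case: (y \in k).
  rewrite -addn1 leq_add2l; apply/card_le1_eqP => k k'.
  rewrite !in_pencil => /andP[/andP[kp vk] yk] /andP[/andP[kp' vk'] yk'].
  exact: (edge_eq linH (plane_edge kp') (plane_edge kp) yk' yk vk' vk yv).
have le2 : #|pencil (opposite p v) y| <= #|(l :\ v) :&: cover (pencil (plane p) y)|.
  apply: (@leq_trans #|(l :\ v) :&: cover (pencil (opposite p v) y)|); last first.
    apply/subset_leq_card/setIS/bigcupsP => k.
    rewrite in_pencil in_opposite => /andP[/andP[kp _] yk].
    by apply: (bigcup_max k); rewrite // in_pencil kp.
  apply: leq_trans (card_meeting linH oH yS).
  apply/subset_leq_card/subsetP => k ko; rewrite inE ko /=.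
  have ko' : k \in opposite p v by move: ko; rewrite inE => /andP[].
  have [z zl zk] := opposite_meet pP lv ko'.
  by apply/overlapP; exists z.
apply: (leq_complement _ le1 le2).
by rewrite cardsID (card_line_point lv').
Qed.

Definition points p v := cover (pencil (plane p) v) :\ v.

Definition unjoined p v : {set T * T} :=
  [set z | [&& z.1 \in points p v, z.2 \in points p v
             & z.2 \notin cover (pencil (plane p) z.1)]].

Lemma in_unjoined p v z : (z \in unjoined p v) =
  [&& z.1 \in points p v, z.2 \in points p v
    & z.2 \notin cover (pencil (plane p) z.1)].
Proof. by rewrite inE. Qed.

Lemma card_unjoined p v : p \in P -> v \in e :\: cover P ->
  #|unjoined p v| <= q * q * (t * q + sigma).
Proof.
move=> pP /[dup] vf /setDP[ve vP].
have le1 y : y \in points p v -> #|points p v :\: cover (pencil (plane p) y)| <=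
    q * (q.+1 - #|pencil (plane p) y|).
  move=> yV; rewrite /points setDDl; apply: leq_trans (card_cover_le _ _) _.
  apply: (@leq_trans (#|pencil (plane p) v| * (q.+1 - #|pencil (plane p) y|))).
    rewrite -sum_nat_const; apply: leq_sum => l lv; rewrite -setDDl.
    have [yl|yl] := boolP (y \in l); last exact: card_unjoined_line.
    rewrite (_ : _ :\: _ = set0) ?cards0 //; apply/eqP; rewrite setD_eq0.
    apply: subset_trans (subsetDl _ _) (sub_cover _).
    by move: lv; rewrite !in_pencil => /andP[->].
  by rewrite leq_mul2r card_pencil_plane_le // orbT.
have -> : #|unjoined p v| =
    \sum_(y in points p v) #|points p v :\: cover (pencil (plane p) y)|.
  under [RHS]eq_bigr => y _ do rewrite -sum1_card.
  rewrite pair_big_dep /= -sum1_card; apply: eq_bigl => -[y y'].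
  by rewrite !inE /=; congr (_ && _); rewrite andbC.
apply: leq_trans (leq_sum _ le1) _; rewrite -big_distrr /= -mulnA leq_mul2l.
apply/orP; right; apply: leq_trans (sum_cover_le _ _ _) _.
apply: (@leq_trans (#|pencil (plane p) v| * (t * q + sigma))).
  by rewrite -sum_nat_const; apply: leq_sum => l lv; apply: sum_plane_deficit.
by rewrite leq_mul2r card_pencil_plane_le // orbT.
Qed.

Definition missed v (g : {set T}) := g :\: cover (pencil H v).

(** A point of g joined to v lies on a line through v, since g is disjoint from
    e.  This line is in a plane unless it is one of the at most def v exceptional
    ones, each of which has at most one point on g. *)
Lemma sum_points_ge v g : v \in e :\: cover P -> g \in H -> [disjoint g & e] ->
  #|missed v g| <= def v -> 4 * def v <= q ->
  q <= 2 * \sum_(p in P) #|g :&: points p v|.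
Proof.
move=> /[dup] vf /setDP[ve vP] gH ge gv vq.
have vg : v \notin g.
  by apply/negP => vg; have /pred0P/(_ v) := ge; rewrite /= vg ve.
have lex : #|g :&: cover (exceptional v)| <= #|exceptional v|.
  rewrite setIC -[g]setCK -setDE -[leqRHS]sum1_card; apply: leq_trans (card_cover_le _ _) _.
  apply: leq_sum => k; rewrite inE => /andP[kv _]; rewrite setDE setCK.
  have /andP[/neighborsP[kH ke _] vk] : (k \in line) && (v \in k).
    by rewrite -in_pencil.
  by apply: linH => //; apply: contraNneq vg => <-.
have le1 : #|g :&: cover (pencil H v)| <=
    \sum_(p in P) #|g :&: points p v| + #|g :&: cover (exceptional v)|.
  rewrite card_setI_sum; under [X in _ <= X + _]eq_bigr => p _ do rewrite card_setI_sum.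
  rewrite exchange_big card_setI_sum -big_split /=; apply: leq_sum => y yg.
  case: bigcupP => //= -[k]; rewrite in_pencil => /andP[kH vk] yk.
  have kv : k \in pencil line v.
    rewrite mem_pencil_nbr // kH vk andbT /=; apply/negP => /eqP ke.
    by have /pred0P/(_ y) := ge; rewrite /= yg -ke yk.
  have [kx|] := boolP (k \in exceptional v).
    by rewrite (subsetP (sub_cover kx) y yk) addn1.
  rewrite inE kv /= negb_forall_in => /exists_inP[p pP]; rewrite negbK => kp.
  rewrite (bigD1 p) //= -addnA (_ : y \in points p v); first by [].
  rewrite in_setD1 (contraNneq _ vg) => [|<- //].
  by apply/bigcupP; exists k => //; rewrite in_pencil kp.
have := cardsID (cover (pencil H v)) g; rewrite (uniH gH) -/(missed v g) => eqg.
apply: (leq_half_cover eqg _ gv vq); apply: leq_trans le1 _; rewrite leq_add2l.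
exact: leq_trans lex (card_exceptional vf).
Qed.

(** Two points of an edge g disjoint from e are joined by no line, as that line
    would be g; and the pairs coming from different edges are different. *)
Lemma sum_unjoined_pairs (B : {set {set T}}) p v : B \subset H ->
  v \in e -> (forall g, g \in B -> [disjoint g & e]) ->
  \sum_(g in B) #|g :&: points p v| ^ 2 <=
    #|unjoined p v| + \sum_(g in B) #|g :&: points p v|.
Proof.
move=> /subsetP BH ve Be.
pose pairs (g : {set T}) := [set z in unjoined p v | (z.1 \in g) && (z.2 \in g)].
have in_pairs g z :
    (z \in pairs g) = [&& z \in unjoined p v, z.1 \in g & z.2 \in g].
  by rewrite inE.
have le1 : \sum_(g in B) #|pairs g| <= #|unjoined p v|.
  under eq_bigr => g _ do rewrite -sum1_card.
  rewrite (exchange_big_dep (fun z => z \in unjoined p v)) /=; last first.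
    by move=> g z _; rewrite inE => /andP[].
  rewrite -sum1_card; apply: leq_sum => z zW; rewrite sum1dep_card.
  apply/card_le1_eqP => g g'.
  rewrite [g \in _]in_set [g' \in _]in_set !in_pairs => /andP[gB /and3P[_ z1 z2]] /andP[gB' /and3P[_ z1' z2']].
  apply: (edge_eq linH (BH _ gB') (BH _ gB) z1' z1 z2' z2).
  move: zW; rewrite inE => /and3P[/setD1P[_ zV] _]; apply: contraNneq => <-.
  case/bigcupP: zV => k; rewrite in_pencil => /andP[kp _] zk.
  by apply/bigcupP; exists k; rewrite // in_pencil kp.
apply: leq_trans (leq_add le1 (leqnn _)).
rewrite -big_split /=; apply: leq_sum => g gB.
rewrite -mulnn -cardsX -[X in _ <= _ + X](card_imset _ (f := fun y => (y, y))); last first.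
  by move=> y y' [].
apply: leq_trans (leq_card_setU _ _).1; apply/subset_leq_card/subsetP => -[y y'].
move=> /setXP[/= /setIP[yg yV] /setIP[y'g y'V]]; apply/setUP.
have [->|yy'] := eqVneq y' y; first by right; apply: imset_f; rewrite inE yg.
left; rewrite in_pairs in_unjoined /= yV y'V yg y'g /= andbT.
apply/bigcupP => -[k]; rewrite in_pencil => /andP[kp yk] y'k.
have kg := edge_eq linH (plane_edge kp) (BH _ gB) y'k y'g yk yg yy'.
have /neighborsP[_ _ [x xk xe]] := plane_line kp.
by have /pred0P/(_ x) := Be _ gB; rewrite /= -kg xk xe.
Qed.

(** Call an edge disjoint from e absorbed if at most def v of its points are not
    joined to v.  By [sum_points_ge] and [sum_sqr_ge] it contains at least
    q^2 / (8t) pairs counted by the t families [unjoined], which have at most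
    t q^2 (tq + sigma) elements in all. *)
Lemma card_absorbed (B : {set {set T}}) v : B \subset H -> v \in e :\: cover P ->
  4 * def v <= q -> 4 * t <= q -> 0 < q ->
  (forall g, g \in B -> [disjoint g & e] /\ #|missed v g| <= def v) ->
  #|B| <= 8 * t * (t * (t * q + sigma)).
Proof.
move=> BH /[dup] vf /setDP[ve vP] vq tq q0 Bg.
pose n g := \sum_(p in P) #|g :&: points p v|.
pose n2 g := \sum_(p in P) #|g :&: points p v| ^ 2.
have le1 : #|B| * (q * q) + 8 * t * \sum_(g in B) n g <=
    8 * t * \sum_(g in B) n2 g.
  rewrite -sum_nat_const !big_distrr -big_split /=; apply: leq_sum => g gB.
  have [ge gv] := Bg g gB.
  rewrite -cP; apply: sum_sqr_ge; first by rewrite cP.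
  exact: sum_points_ge vf (subsetP BH g gB) ge gv vq.
have le2 : \sum_(g in B) n2 g <=
    t * (q * q * (t * q + sigma)) + \sum_(g in B) n g.
  rewrite exchange_big [X in _ <= _ + X]exchange_big /= -cP -sum_nat_const cP -big_split.
  apply: leq_sum => p pP /=.
  apply: leq_trans (sum_unjoined_pairs p BH ve (fun g gB => (Bg g gB).1)) _.
  by rewrite leq_add2r card_unjoined.
have qq : 0 < q * q by rewrite muln_gt0 q0.
rewrite -(leq_pmul2r qq).
move: le1 le2; move: (\sum_(g in B) n g) (\sum_(g in B) n2 g) sigma #|B|; clear.
move=> N N2 s b le1 le2.
have := leq_trans le1 (leq_mul (leqnn (8 * t)) le2); rewrite mulnDr leq_add2r.
by move/leq_trans; apply; nia.
Qed.

Section BalancedLine.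
Variables (p f : {set T}) (v : T).
Hypotheses (pP : p \in P) (vf : v \in e :\: cover P).
Hypothesis fv : f \in pencil (plane p) v.

Let ve : v \in e. Proof. by case/setDP: vf. Qed.
Let fp : f \in plane p. Proof. by move: fv; rewrite in_pencil => /andP[]. Qed.
Let vf' : v \in f. Proof. by move: fv; rewrite in_pencil => /andP[]. Qed.
Let fH : f \in H. Proof. exact: plane_edge fp. Qed.

(** The points of f at which petals can be found: both thresholds are positive
    fractions of q, so that a good point keeps more than (t - 2)q candidate
    petals ([good_candidates]), while few points fail either of them. *)
Definition good : {set T} :=
  [set x in f :\ v | (4 * (q.+1 - #|pencil (plane p) x|) <= q) && (2 * def x <= q)].

Lemma goodP x : x \in good -> [/\ x \in f, x != v,
  4 * (q.+1 - #|pencil (plane p) x|) <= q & 2 * def x <= q].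
Proof. by rewrite inE in_setD1 => /andP[/andP[-> ->] /andP[]]. Qed.

(** Markov's inequality: a point of f which is not good contributes at least q
    to the sum of the two error terms. *)
Lemma card_good_ge :
  q * q <= q * #|good| + 4 * (t * q + sigma) + 2 * \sum_(x in f) def x.
Proof.
have fl := subsetP (sub_pencil_plane p v) f fv.
have le1 : q * #|(f :\ v) :\: good| <= 4 * (t * q + sigma) + 2 * \sum_(x in f) def x.
  apply: (@leq_trans (\sum_(x in f :\ v)
      (4 * (q.+1 - #|pencil (plane p) x|) + 2 * def x))).
    rewrite mulnC -sum_nat_const.
    rewrite [leqRHS](big_setID good) /=; apply: leq_trans (leq_addl _ _).
    apply: leq_sum => x /setDP[xf]; rewrite inE xf /= negb_and -!ltnNge.
    by case/orP => /ltnW; [move/leq_trans | move=> lt2; apply: leq_trans lt2 _];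
      [apply; apply: leq_addr | apply: leq_addl].
  rewrite big_split -!big_distrr; apply: leq_add.
    by rewrite leq_mul2l sum_plane_deficit.
  by rewrite leq_mul2l (big_setD1 v vf') leq_addl.
rewrite -addnA; apply: leq_trans (leq_add (leqnn _) le1).
rewrite -mulnDr leq_mul2l -[X in X <= _](card_line_point fl); apply/orP; right.
have := cardsID good (f :\ v); have : #|(f :\ v) :&: good| <= #|good|.
  exact/subset_leq_card/subsetIr.
by move: #|good| #|_ :\: _| #|_ :&: _| #|_ :\ _|; clear; lia.
Qed.

Section Candidates.
Variables (h : {set T}) (w : T).
Hypotheses (hp : h \in plane p) (hf : h != f) (wh : w \in h) (wf : w \in f).

Definition candidates x : {set {set T}} :=
  [set g in pencil (neighbors H f) x | [disjoint g & e] && [disjoint g & h]].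

Lemma candidatesP x g : x \in f -> g \in candidates x ->
  [/\ g \in H, g != f, x \in g, [disjoint g & e] & [disjoint g & h]].
Proof. by move=> xf; rewrite inE mem_pencil_nbr // => /andP[/and3P[-> -> ->] /andP[]]. Qed.

(** At most q edges through x other than f meet e, and at most q meet h.  The
    lines of the plane through x, apart from f, do both; so when x is on nearly
    q + 1 of them, little more than q edges are lost in total. *)
Lemma card_candidates x : x \in f -> x != v -> x != w ->
  degree H x + #|pencil (plane p) x| <= #|candidates x| + (2 * q).+2.
Proof.
move=> xf xv xw; set N := pencil (neighbors H f) x.
have cN : #|N|.+1 = degree H x by apply: card_pencil_nbr.
have NH : neighbors H f \subset H by apply: nbr_sub.
have hl : h \in line by apply: plane_line hp.
have hH : h \in H by apply: plane_edge hp.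
have meetD (S : {set T}) z : S \in H -> z \in S -> z \in f -> x != z ->
    x \notin S -> #|meeting N S| <= q.
  move=> SH zS zf xz xS.
  have -> : q = #|S :\ z| by have := cardsD1 z S; rewrite zS (uniH SH) => -[].
  apply: leq_trans (subset_leq_card (subsetIl _ (cover N))).
  apply: (leq_trans _ (card_meeting linH NH _)); last by rewrite inE (negPf xS) andbF.
  apply/subset_leq_card/subsetP => k; rewrite !in_meeting => /andP[kN].
  rewrite kN => /overlapP[y yk yS]; apply/overlapP; exists y; rewrite // in_setD1 yS andbT.
  move: kN; rewrite mem_pencil_nbr // => /and3P[kH kf xk].
  apply: contraNneq kf => yz; apply/eqP.
  by apply: (edge_eq linH kH fH xk xf yk _ _); rewrite yz.
have xe : x \notin e.
  apply: contra xv => xe; apply/eqP.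
  have fl := subsetP (sub_pencil_plane p v) f fv.
  exact: (line_base fl ve xf xe).
have xh : x \notin h.
  by apply: contra hf => xh; rewrite (edge_eq linH hH fH xh xf wh wf xw).
have le1 := meetD e v eH ve vf' xv xe.
have le2 := meetD h w hH wh wf xw xh.
(* f itself is the line of the plane through x that is not in N *)
have le3 : #|pencil (plane p) x| <= #|meeting N e :&: meeting N h|.+1.
  rewrite (cardsD1 f) in_pencil fp xf add1n ltnS.
  apply/subset_leq_card/subsetP => k; rewrite in_setD1 in_pencil => /and3P[kf kp xk].
  have kN : k \in N by rewrite mem_pencil_nbr // kf xk (plane_edge kp).
  rewrite in_setI !in_meeting kN /=; apply/andP; split; apply/overlapP.
    by have /neighborsP[_ _ [y yk ye]] := plane_line kp; exists y.
  exact: plane_meet pP kp hp.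
have le4 : #|N| <= #|candidates x| + #|meeting N e :|: meeting N h|.
  apply: leq_trans (leq_card_setU _ _).1; apply/subset_leq_card/subsetP => k kN.
  rewrite in_setU [k \in candidates x]inE in_setU !in_meeting kN /=.
  by case: [disjoint k & e]; case: [disjoint k & h].
have := cardsUI (meeting N e) (meeting N h); move: cN le1 le2 le3 le4.
move: #|candidates x| #|meeting N e| #|meeting N h| #|N| #|_ :|: _| #|_ :&: _|.
by move: #|pencil (plane p) x| (degree H x); clear; lia.
Qed.

Lemma good_candidates x : x \in good -> x != w ->
  4 * (t * q) <= 4 * #|candidates x| + 7 * q.
Proof.
move=> /goodP[xf xv xa xd] xw; have := card_candidates xf xv xw.
move: xa xd; rewrite /deficiency.
by move: #|pencil (plane p) x| (degree H x) #|candidates x|; clear; lia.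
Qed.

(** Otherwise all candidates at good points are absorbed by the neighbourhood of
    v, and there are more of them than [card_absorbed] permits. *)
Lemma petal_leaving_neighborhood : 2 <= t -> 1000 * t ^ 2 <= q -> 1000 * (t * sigma) <= q * q ->
  4 * def v <= q -> 3 * q <= 4 * #|good| ->
  exists x g, [/\ x \in good :\ w, g \in candidates x & def v < #|missed v g|].
Proof.
move=> t2 tq sq vq gq.
pose B := [set g in neighbors H f | [&& [disjoint g & e], [disjoint g & h]
   & ~~ [disjoint g & good :\ w]]].
have BP g : g \in B -> [/\ g \in neighbors H f, [disjoint g & e], [disjoint g & h]
   & exists2 x, x \in g & x \in good :\ w].
  by rewrite inE => /and4P[? ? ? /overlapP].
have BH : B \subset H by apply/subsetP => g /BP[/neighborsP[]].
have [/exists_inP[g gB gv]|] := boolP [exists g in B, def v < #|missed v g|].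
  have [gf ge gh [x xg xX]] := BP g gB; exists x, g; split=> //.
  by rewrite inE in_pencil gf xg ge gh.
rewrite negb_exists_in => /forall_inP Bv.
have tq4 : 4 * t <= q by clear -t2 tq; nia.
have q0 : 0 < q by clear -t2 tq; nia.
have Bc g : g \in B -> [disjoint g & e] /\ #|missed v g| <= def v.
  by move=> gB; have [_ ge _ _] := BP g gB; split; rewrite // leqNgt Bv.
have le0 := card_absorbed BH vf vq tq4 q0 Bc.
have le1 : \sum_(x in good :\ w) #|candidates x| <= #|B|.
  apply: leq_trans (_ : \sum_(x in good :\ w) #|pencil B x| <= _).
    apply: leq_sum => x xX; have /setD1P[_ /goodP[xf _ _ _]] := xX.
    apply/subset_leq_card/subsetP => g /(candidatesP xf)[gH gf xg ge gh].
    rewrite in_pencil xg andbT inE ge gh /=; apply/andP; split.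
      by apply/neighborsP; split=> //; exists x.
    by apply/overlapP; exists x.
  apply: sum_pencil_nbr_le fH _ _ => //; first by apply/subsetP => g /BP[].
  by apply/subsetP => x /setD1P[_ /goodP[]].
have le2 : #|good :\ w| * (t * q) <= \sum_(x in good :\ w) 8 * #|candidates x|.
  rewrite -sum_nat_const; apply: leq_sum => x /setD1P[xw xX].
  by have := good_candidates xX xw; move: #|candidates x| t2; clear; nia.
rewrite -big_distrr /= in le2.
have cX : #|good| <= #|good :\ w|.+1 by rewrite (cardsD1 w good) -[leqRHS]add1n leq_add2r leq_b1.
have qX : q <= 2 * #|good :\ w| by move: #|good| #|_| gq cX q0 tq4 t2; clear; lia.
case: (absorbed_bound_fails t2 q0 tq sq qX).
by rewrite (leq_trans le2) // leq_mul2l (leq_trans le1).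
Qed.
End Candidates.

(** The crown with base f described above: t - 1 petals at good points, one in
    the plane, one at v. *)
Lemma defective_line : 2 <= t -> 1000 * t ^ 2 <= q -> 1000 * (t * sigma) <= q * q ->
  4 * def v <= q -> q * q < 25 * \sum_(x in f) def x.
Proof.
move=> t2 tq sq vq; rewrite ltnNge; apply/negP => dq.
have q0 : 0 < q by move: t2 tq; clear; rewrite -mulnn; nia.
have tq9 : 9 * t <= q by move: t2 tq; clear; rewrite -mulnn; nia.
have gq : 3 * q <= 4 * #|good| := many_good t2 q0 tq sq dq card_good_ge.
have [w wg] : exists w, w \in good by apply/card_gt0P; move: q0 gq; clear; lia.
have [wf wv wa _] := goodP wg.
have [h] : exists h, h \in pencil (plane p) w :\ f.
  apply/card_gt0P; move: wa; rewrite (cardsD1 f (pencil _ _)) in_pencil fp wf.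
  by move: #|_| q0 tq9 t2; clear; lia.
case/setD1P=> hf; rewrite in_pencil => /andP[hp wh].
have hH := plane_edge hp.
have vh : v \notin h.
  by apply: contra hf => vh; rewrite (edge_eq linH hH fH vh vf' wh wf) // eq_sym.
have [x1 [g1 [/setD1P[x1w x1g] g1C g1v]]] := petal_leaving_neighborhood hp hf wh wf t2 tq sq vq gq.
have [x1f x1v _ _] := goodP x1g.
have [g1H g1f x1g1 g1e g1h] := candidatesP x1f g1C.
have nbr_f g x : g \in H -> g != f -> x \in g -> x \in f -> g \in neighbors H f.
  by move=> gH gf xg xf; apply/neighborsP; split=> //; exists x.
(* the petals away from e; starting from g1 leaves t - 2 greedy steps *)
have [G [Gf cG /subsetP g1G inG]] : exists G, [/\ petal_family H f G, #|G| = t.-1,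
    [set g1] \subset G & forall g, g \in G ->
      g \in [set g1] \/ exists2 x, x \in good :\ w :\ x1 & g \in candidates h x].
  apply: (petal_extend uniH linH fH).
  - rewrite /petal_family sub1set (nbr_f _ _ g1H g1f x1g1 x1f) /=.
    by apply/trivIsetP => A B /set1P-> /set1P->; rewrite eqxx.
  - by apply/subsetP => x /setD1P[_ /setD1P[_ /goodP[]]].
  - rewrite cover1; apply/pred0P => y /=; apply/negP.
    case/andP=> /setD1P[yx1 /setD1P[_ /goodP[yf _ _ _]]] yg1; case/eqP: yx1.
    exact: (meet_point linH g1H fH g1f x1g1 x1f yg1 yf).
  - by move=> x _; apply/subsetP => g; rewrite inE => /andP[].
  - move=> x /setD1P[_ /setD1P[xw xg]].
    by have := good_candidates hp hf wh wf xg xw; move: #|_| t2 q0; clear; nia.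
  - rewrite cards1; have := cardsD1 w good; have := cardsD1 x1 (good :\ w).
    by move: #|_| #|_| #|_| gq t2 q0 tq9; clear; lia.
have Gg g : g \in G -> [/\ g \in H, [disjoint g & e] & [disjoint g & h]].
  case/inG=> [/set1P->//|[x /setD1P[_ /setD1P[_ /goodP[xf _ _ _]]]]].
  by case/(candidatesP xf).
have hG : [disjoint h & cover G].
  by rewrite disjoint_cover; apply/forall_inP => g /Gg[_ _]; rewrite disjoint_sym.
have [hGf chG] := petal_familyU1 uniH fH Gf (nbr_f _ _ hH hf wh wf) hG.
set F := h |: G in hGf chG.
have vF : v \notin cover F.
  apply/bigcupP => -[k /setU1P[->|kG] vk]; first by rewrite vk in vh.
  by have [_ /pred0P/(_ v) /=] := Gg k kG; rewrite vk ve.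
set N := pencil (neighbors H f) v.
have : ~~ (N \subset meeting N (cover F :\: f)).
  apply/negP => /subset_leq_card.
  have [Fn _] := andP hGf.
  have vS : v \notin cover F :\: f by rewrite inE vf'.
  move/leq_trans/(_ (card_meeting linH (nbr_sub _ _) vS)).
  (* g1 is counted apart: its points not joined to v block no edge through v *)
  have le1 : #|(cover F :\: f) :&: cover N| <=
      #|cover (F :\ g1) :\: f| + #|(g1 :\: f) :&: cover (pencil H v)|.
    apply: leq_trans (leq_card_setU _ _).1; apply/subset_leq_card/subsetP => y.
    case/setIP=> /setDP[/bigcupP[k kF yk] yf] /bigcupP[l lN yl].
    rewrite in_setU in_setI !in_setD yf /=.
    have [kg1|kg1] := eqVneq k g1; last first.
      by apply/orP; left; apply/bigcupP; exists k; rewrite // in_setD1 kg1.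
    apply/orP; right; rewrite -kg1 yk; apply/bigcupP; exists l => //.
    by move: lN; rewrite mem_pencil_nbr // in_pencil => /and3P[-> _ ->].
  have le2 : #|cover (F :\ g1) :\: f| <= t.-1 * q.
    have -> : t.-1 = #|F :\ g1|.
      apply/eqP; rewrite -eqSS -cG -chG (cardsD1 g1 F) in_setU1 g1G ?set11 // orbT.
      by rewrite add1n.
    have F'n : F :\ g1 \subset neighbors H f by apply: subset_trans (subsetDl _ _) Fn.
    have le2 := card_coverD uniH linH fH F'n; exact: le2.
  have le3 : #|(g1 :\: f) :&: cover (pencil H v)| + #|missed v g1| <= q.
    rewrite -(card_edgeD uniH linH fH (nbr_f _ _ g1H g1f x1g1 x1f)).
    rewrite -(cardsID (cover (pencil H v)) (g1 :\: f)) leq_add2l.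
    apply/subset_leq_card/subsetP => y /setDP[yg yN]; rewrite !in_setD yg yN andbT.
    apply: contra yN => yf; apply/bigcupP; exists f => //.
    by rewrite in_pencil fH vf'.
  apply/negP; rewrite -ltnNge; apply: leq_ltn_trans le1 _.
  apply: leq_ltn_trans (leq_add le2 (leqnn _)) _.
  exact: petal_room (ltnW t2) (card_pencil_nbr fH vf') (degE ve) g1v le3.
case/subsetPn=> l lN; rewrite in_meeting lN /= negbK => dl.
have [lH lf vl] : [/\ l \in H, l != f & v \in l].
  by move: lN; rewrite mem_pencil_nbr // => /and3P.
have dlF : [disjoint l & cover F].
  apply/pred0P => y /=; apply/negP => /andP[yl yF].
  have [yf|yf] := boolP (y \in f).
    by case/negP: vF; rewrite -(meet_point linH lH fH lf vl vf' yl yf).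
  by have /pred0P/(_ y) := dl; rewrite /= yl in_setD yf yF.
have [lFf clF] := petal_familyU1 uniH fH hGf (nbr_f _ _ lH lf vl vf') dlF.
have := petal_family_le uniH linH cfH fH lFf.
by rewrite clF chG cG; case: (t) t2 => //= n _; rewrite ltnn.
Qed.
End BalancedLine.
End Planes.

Section NearlyTight.
Variables (T : finType) (q t : nat) (H : {set {set T}}).
Hypothesis uniH : uniform q.+1 H.
Hypothesis linH : linear_hypergraph H.
Hypothesis cfH : crown_free t.+1 H.
Hypothesis t2 : 2 <= t.
Hypothesis tq : 1000 * t ^ 2 <= q.
Implicit Types (e f : {set T}).

Local Notation def := (deficiency (t * q + 1) H).

Let tq1 : 1000 * t <= q.
Proof. by move: t2 tq; clear; rewrite -mulnn; nia. Qed.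

Let q0 : 0 < q.
Proof. by move: t2 tq1; clear; lia. Qed.

Lemma petal_family0 e : petal_family H e set0.
Proof. by rewrite /petal_family sub0set; apply/trivIsetP => A B; rewrite inE. Qed.

Lemma petal_family_exists e : e \in H -> 2 * (\sum_(u in e) def u) <= q * q ->
  exists2 P, petal_family H e P & #|P| = t.
Proof.
move=> eH sq; pose S := [set u in e | def u < q].
have le1 : #|e :\: S| * q <= \sum_(u in e) def u.
  rewrite -sum_nat_const [leqRHS](big_setID S) /=; apply: leq_trans (leq_addl _ _).
  by apply: leq_sum => u /setDP[ue]; rewrite inE ue -leqNgt.
have Se : S \subset e by apply/subsetP => u; rewrite inE => /andP[].
have [P [Pf cP _ _]] : exists P, [/\ petal_family H e P, #|P| = t, set0 \subset P &
    forall k, k \in P -> k \in set0 \/ exists2 u, u \in S & k \in pencil (neighbors H e) u].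
  apply: (petal_extend uniH linH eH (petal_family0 e) Se).
  - by rewrite /cover big_set0 -setI_eq0 setI0.
  - by [].
  - move=> u; rewrite inE => /andP[ue]; have := card_pencil_nbr eH ue.
    rewrite /deficiency; move: #|_| (degree H u) t2 => a d; clear.
    by case: t => // n _; rewrite mulSn /=; lia.
  - rewrite cards0 /=; have := cardsID S e; rewrite (setIidPr Se) (uniH eH).
    by move: #|S| #|_| le1 sq t2 tq1 q0; clear; nia.
by exists P.
Qed.

(** For a point u of e that is off P and has 4 def u <= q, all lines through u
    but at most def u lie in planes, and [defective_line] applies to them.  The
    term 4t def u makes the estimate trivial when 4 def u > q, and there are at
    most t points of e on P. *)
Lemma many_defective e : e \in H -> (forall u, u \in e -> degree H u <= t * q + 1) ->
  1000 * (t * (\sum_(u in e) def u)) <= q * q ->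
  q.+1 * (t * q) <= 2 * #|[set f in neighbors H e | q * q < 25 * (\sum_(x in f) def x)]|.
Proof.
move=> eH degE sq; set Bad := [set f in _ | _].
have sq2 : 2 * (\sum_(u in e) def u) <= q * q.
  by move: (\sum_(u in e) _) sq t2; clear; nia.
have [P Pf cP] := petal_family_exists eH sq2.
have leu u : u \in e ->
    t * q <= #|pencil Bad u| + 4 * t * def u + t * q * (u \in cover P).
  move=> ue; have [uP|uP] := boolP (u \in cover P); first by rewrite muln1 leq_addl.
  rewrite muln0 addn0; have [uq|/ltnW uq] := leqP (4 * def u) q; last first.
    by apply: leq_trans (leq_addl _ _); rewrite [4 * t]mulnC -mulnA leq_mul2l uq orbT.
  have uf : u \in e :\: cover P by rewrite inE uP.
  have le1 : #|pencil (neighbors H e) u| <= #|pencil Bad u| + #|exceptional H e P u|.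
    apply: leq_trans (leq_card_setU _ _).1; apply/subset_leq_card/subsetP => k ku.
    rewrite in_setU; have [//|kx] := boolP (k \in exceptional _ _ _ _).
      by rewrite orbT.
    move: kx; rewrite inE ku /= negb_forall_in => /exists_inP[p pP]; rewrite negbK => kp.
    move: ku; rewrite orbF !in_pencil => /andP[kl uk]; rewrite uk andbT inE kl /=.
    apply: (defective_line uniH linH cfH eH degE Pf cP pP uf _ t2 tq sq uq).
    by rewrite in_pencil kp.
  have := card_lines eH degE ue; have := card_exceptional uniH linH cfH eH degE Pf cP uf.
  by move: le1; move: #|_| #|_| #|_| (def u) t2; clear; nia.
have BadS : Bad \subset neighbors H e by apply/subsetP => f; rewrite inE => /andP[].
have : \sum_(u in e) t * q <=
    \sum_(u in e) (#|pencil Bad u| + 4 * t * def u + t * q * (u \in cover P)).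
  exact: leq_sum.
rewrite sum_nat_const (uniH eH) !big_split /= -!big_distrr /= -card_setI_sum.
have := sum_pencil_nbr_le linH eH BadS (subxx e).
have := card_bases linH eH Pf cP.
move: (\sum_(u in e) #|_|) #|Bad| (\sum_(u in e) def u) #|_ :&: _| sq t2 tq1 q0.
clear; move=> x b s c sq t2 tq1 q0 ct xb le1.
have le2 : t * q * c <= t * q * t by rewrite leq_mul2l ct orbT.
have le3 : 1000 * t * (t * q) <= q * (t * q) by rewrite leq_mul2r tq1 orbT.
have le4 : q * q <= q * (t * q) by rewrite leq_mul2l leq_pmull ?orbT // ltnW.
by move: le1 le2 le3 le4 sq xb; rewrite mulSn; clear; nia.
Qed.

Section Reals.
Variable R : realType.
Local Open Scope ring_scope.

Lemma degree_gt0 f v : f \in H -> v \in f -> (0 < degree H v)%N.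
Proof. by move=> fH vf; rewrite /degree; apply/card_gt0P; exists f; rewrite inE fH. Qed.

(** If t points of f other than w had degree above (t - 1)q + 1, then t disjoint
    petals could be chosen at them greedily, and a petal at w, where more than
    tq edges besides f are available, would complete a crown.  So at least
    q + 1 - t points have smaller degree. *)
Lemma defect_of_large_degree f w : f \in H -> w \in f ->
  (t * q + 1 < degree H w)%N ->
  (q - t.-1)%:R / (t.-1 * q + 1)%:R <= \sum_(v in f) (degree H v)%:R^-1 :> R.
Proof.
move=> fH wf dw; pose S := [set v in f :\ w | (t.-1 * q + 1 < degree H v)%N].
have Sf : S \subset f by apply/subsetP => v; rewrite inE => /andP[/setD1P[]].
have ltS : (#|S| < t)%N.
  rewrite ltnNge; apply/negP => leS.
  have [P [Pf cP _ PS]] : exists P, [/\ petal_family H f P, #|P| = t, set0 \subset P &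
      forall k, k \in P ->
        k \in set0 \/ exists2 v, v \in S & k \in pencil (neighbors H f) v].
    apply: (petal_extend uniH linH fH (petal_family0 f) Sf).
    - by rewrite /cover big_set0 -setI_eq0 setI0.
    - by [].
    - move=> v vS; have vf := subsetP Sf v vS; move: vS; rewrite inE => /andP[_].
      have := card_pencil_nbr fH vf.
      by move: #|_| (degree H v) => a d; clear; lia.
    - by rewrite cards0.
  have wP : w \notin cover P.
    apply/bigcupP => -[k /PS[k0|[v vS kv]] wk]; first by rewrite inE in k0.
    have vf := subsetP Sf v vS; move: vS; rewrite inE => /andP[/setD1P[/negP[]]].
    move: kv; rewrite mem_pencil_nbr // => /and3P[kH kf vk].
    by apply/eqP; apply: (meet_point linH kH fH kf wk wf vk vf).
  have [|k _ [kPf ck]] := petal_extend1 uniH linH fH Pf wf wP (subxx _).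
    have := card_pencil_nbr fH wf; rewrite cP; move: dw.
    by move: #|_| (degree H w) => a d; clear; lia.
  have := petal_family_le uniH linH cfH fH kPf.
  by rewrite ck cP ltnn.
pose L := (f :\ w) :\: S.
have leL : (q - t.-1 <= #|L|)%N.
  have := cardsID S (f :\ w); have := cardsD1 w f; rewrite wf (uniH fH).
  have := subset_leq_card (subsetIr (f :\ w) S); rewrite -/L; move: ltS.
  by move: #|_ :&: _| #|L| #|S| #|_|; clear; lia.
have Lf : L \subset f by apply: subset_trans (subsetDl _ _) (subsetDl _ _).
rewrite (big_setID L) /= (setIidPr Lf).
apply: ler_wpDr; first by apply: sumr_ge0 => v _; rewrite invr_ge0 ler0n.
apply: (@le_trans _ _ (\sum_(v in L) (t.-1 * q + 1)%:R^-1)).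
  rewrite sumr_const -[X in _ <= X]mulr_natl ler_wpM2r ?invr_ge0 ?ler0n //.
  by rewrite ler_nat.
apply: ler_sum => v vL; rewrite lef_pV2 ?posrE ?ltr0n ?addn1 //; last first.
  by apply: degree_gt0 fH _; apply: (subsetP Lf).
move: vL => /setDP[vf]; rewrite inE vf /= -leqNgt ler_nat.
by rewrite addn1.
Qed.

Lemma defect_gap : 1 / (2 * t%:R ^+ 2) + q.+1%:R / (t * q + 1)%:R <=
  (q - t.-1)%:R / (t.-1 * q + 1)%:R :> R.
Proof.
have tP : t.-1.+1 = t by rewrite prednK // (ltnW t2).
have a1 : 1 <= t.-1%:R :> R by rewrite (ler_nat R 1); move: t2; clear; lia.
have tq' : 1000 * (t.-1%:R + 1) ^+ 2 <= q%:R :> R.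
  by rewrite natr1 tP -natrX -natrM ler_nat.
have tE : t%:R = t.-1%:R + 1 :> R by rewrite natr1 tP.
have tle : (t.-1 <= q)%N by move: tq1; clear; lia.
rewrite (natrD _ (t * q)%N) (natrD _ (t.-1 * q)%N) !natrM natrB // -(natr1 q) tE.
exact: fraction_gap.
Qed.

Lemma degree_le_of_defect f : f \in H ->
  defect R q.+1 (t * q + 1) H f < 1 / (2 * t%:R ^+ 2) ->
  forall v, v \in f -> (degree H v <= t * q + 1)%N.
Proof.
move=> fH df v vf; rewrite leqNgt; apply/negP => dv.
have := defect_of_large_degree fH vf dv; move: df; rewrite /defect.
set sumd := \sum_(i in f) _ => df led; have gap := defect_gap.
by move: led; rewrite leNgt => /negP[]; lra.
Qed.

(** For 1 <= d <= D, D - d is at most D^2 (1/d - 1/D), and D <= 2tq. *)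
Lemma sum_deficiency_le f : f \in H ->
  (forall v, v \in f -> (degree H v <= t * q + 1)%N) ->
  (\sum_(v in f) def v)%:R <=
    4 * t%:R ^+ 2 * q%:R ^+ 2 * defect R q.+1 (t * q + 1) H f.
Proof.
move=> fH degf; set D := (t * q + 1)%N.
have D0 : 0 < D%:R :> R by rewrite ltr0n /D addn1.
have le1 : (\sum_(v in f) def v)%:R <= D%:R ^+ 2 * defect R q.+1 D H f.
  have -> : defect R q.+1 D H f = \sum_(v in f) ((degree H v)%:R^-1 - D%:R^-1).
    by rewrite sumrB sumr_const -[_ *+ #|f|]mulr_natl (uniH fH).
  rewrite natr_sum mulr_sumr; apply: ler_sum => v vf.
  rewrite natrB ?degf //; have := degf v vf; rewrite -(ler_nat R) -/D.
  have : 0 < (degree H v)%:R :> R by rewrite ltr0n (degree_gt0 fH vf).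
  move: (D%:R : R) ((degree H v)%:R : R) D0 => x d x0 d0 dx.
  have -> : x ^+ 2 * (d^-1 - x^-1) = x / d * (x - d).
    by field; rewrite !gt_eqF.
  by rewrite ler_peMl ?subr_ge0 // ler_pdivlMr // mul1r.
apply: le_trans (le1) _; rewrite ler_wpM2r //.
  by rewrite -(pmulr_rge0 _ (exprn_gt0 2 D0)) (le_trans _ le1).
have D2 : (D ^ 2 <= 4 * t ^ 2 * q ^ 2)%N.
  rewrite /D; move: t2 q0; rewrite -!mulnn; clear; nia.
by rewrite -!natrX -!natrM ler_nat.
Qed.
End Reals.
End NearlyTight.

Local Open Scope ring_scope.

Theorem corollary9p2 (R : realType) :
  exists Q0 eps0 : R, 0 < eps0 /\
  forall (t q : nat), (2 <= t)%N -> (t <= q)%N -> Q0 * t%:R ^+ 2 <= q%:R ->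
  let r := q.+1 in
  let D := (t * q + 1)%N in
  forall (T : finType) (H : {set {set T}}) (e : {set T}),
  uniform r H -> linear_hypergraph H -> crown_free t.+1 H -> e \in H ->
  defect R r D H e < eps0 / t%:R ^+ 3 ->
  2^-1 * r%:R * (D%:R - 1) <=
    #|[set f in neighbors H e | 1 / (100 * t%:R ^+ 2) <= defect R r D H f]|%:R
      :> R.
Proof.
(* D^2 <= 4 t^2 q^2 turns a defect below 1/(4000 t^3) into 1000 t sigma <= q^2,
   and one below 1/(100 t^2) into a total deficiency of at most q^2 / 25 *)
exists 1000, (4000^-1); split; first by rewrite invr_gt0.
move=> t q t2 _ tq r D T H e uniH linH cfH eH de.
have tqN : (1000 * t ^ 2 <= q)%N by rewrite -(ler_nat R) natrM natrX.
have t0 : 2 <= t%:R :> R by rewrite ler_nat.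
have q0 : 0 < q%:R :> R by rewrite ltr0n; move: t2 tqN; rewrite -mulnn; clear; nia.
have t20 : 0 < t%:R ^+ 2 :> R by rewrite exprn_gt0 //; lra.
have t30 : 0 < t%:R ^+ 3 :> R by rewrite exprn_gt0 //; lra.
have degE : forall u, u \in e -> (degree H u <= t * q + 1)%N.
  apply: (degree_le_of_defect uniH linH cfH t2 tqN eH (R := R)).
  apply: lt_le_trans de _.
  rewrite ler_pdivrMr // mulrAC ler_pdivlMr; last by lra.
  by rewrite exprSr; nra.
have se : (1000 * (t * (\sum_(u in e) deficiency D H u)) <= q * q)%N.
  have := sum_deficiency_le uniH t2 tqN R eH degE.
  rewrite -(ler_nat R) !natrM; move: de; rewrite ltr_pdivlMr // -/r -/D.
  move: (defect R r D H e) ((\sum_(u in e) _)%:R : R) => d s de sd.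
  apply: (@le_trans _ _ (4000 * q%:R ^+ 2 * (d * t%:R ^+ 3))).
    have -> : 4000 * q%:R ^+ 2 * (d * t%:R ^+ 3) =
      1000 * (t%:R * (4 * t%:R ^+ 2 * q%:R ^+ 2 * d)) :> R by ring.
    by rewrite ler_pM2l // ler_pM2l //; lra.
  have -> : q%:R * q%:R = 4000 * q%:R ^+ 2 * 4000^-1 :> R by field.
  by apply: ler_wpM2l (ltW de); rewrite mulr_ge0 // exprn_ge0 // ltW.
have := many_defective uniH linH cfH t2 tqN eH degE se.
set B1 := [set f in _ | _]; set B2 := [set f in _ | _] => leB.
have sB : B1 \subset B2.
  apply/subsetP => f; rewrite /B1 /B2 in_set => /andP[fe fq]; rewrite in_set fe /=.
  have /neighborsP[fH _ _] := fe.
  rewrite leNgt; apply/negP => df.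
  have degF : forall u, u \in f -> (degree H u <= t * q + 1)%N.
    apply: (degree_le_of_defect uniH linH cfH t2 tqN fH (R := R)).
    by apply: lt_le_trans df _; rewrite ler_pM2l // lef_pV2 ?posrE; lra.
  have := sum_deficiency_le uniH t2 tqN R fH degF.
  move: fq; rewrite -(ltr_nat R) !natrM; move: df; rewrite ltr_pdivlMr; last by lra.
  move: ((\sum_(u in f) _)%:R : R) => s df fq sd.
  have : 25 * s <= q%:R ^+ 2 * (defect R q.+1 (t * q + 1) H f * (100 * t%:R ^+ 2)).
    by apply: le_trans (ler_wpM2l _ sd) _ => //; lra.
  have : q%:R ^+ 2 * (defect R q.+1 (t * q + 1) H f * (100 * t%:R ^+ 2)) <= q%:R ^+ 2.
    by rewrite ler_piMr ?exprn_ge0 ?(ltW q0) ?(ltW df).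
  by rewrite expr2; lra.
have := leq_trans leB (leq_mul (leqnn 2) (subset_leq_card sB)).
rewrite -(ler_nat R) !natrM /D natrD natrM /r addrK.
lra.
Qed.
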